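(* Let $A$ be a finite alphabet, $F_A$ the free group on $A$, and let $H_i\leqslant K_i\leqslant F_A$, $i\in I$, be a collection of subgroup extensions in $F_A$ ($I$ an arbitrary, possibly infinite, index set). Then: (i) if $H_i\leqslant K_i$ is an onto extension for every $i\in I$, then $\langle H_i,\ i\in I\rangle\leqslant\langle K_i,\ i\in I\rangle$ is an onto extension; (ii) if $H_i\leqslant K_i$ is a fully onto extension for every $i\in I$, then $\langle H_i,\ i\in I\rangle\leqslant\langle K_i,\ i\in I\rangle$ is a fully onto extension.
   Context: Stallings automata. Let $F$ be a free group with basis $C$. An involutive $C$-automaton is a directed graph (loops and parallel edges allowed) with edges labelled by elements of $C\cup C^{-1}$, with a distinguished vertex $\circledcirc$ (the basepoint), in which every edge $e$ from $p$ to $q$ labelled $c$ has an inverse edge $e^{-1}$ from $q$ to $p$ labelled $c^{-1}$. It is deterministic if no two different edges with the same label start (or end) at the same vertex. A path is reduced if it never crosses an edge immediately followed by its inverse. The automaton is trim if every vertex and edge appears in some reduced closed path at $\circledcirc$. A Stallings $C$-automaton is a connected, deterministic, trim involutive $C$-automaton. For each subgroup $H\leqslant F$ there is a unique (up to isomorphism) Stallings $C$-automaton $\Gamma_C(H)$ such that the set of labels of reduced closed paths at $\circledcirc$, read in $F$, is exactly $H$. A $C$-homomorphism between $C$-automata is a map sending vertices to vertices and edges to edges, preserving incidence, labels and basepoint. It is onto if it is surjective both on vertices and on edges. For $H\leqslant K\leqslant F$ there is a unique $C$-homomorphism $\theta_{H,K}\colon \Gamma_C(H)\to\Gamma_C(K)$.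 Let $H\leqslant K\leqslant F_A$. - $H\leqslant K$ is an onto extension if $\theta_{H,K}\colon\Gamma_{A'}(H)\to\Gamma_{A'}(K)$ is onto for every basis $A'$ of $F_A$. - $H\leqslant K$ is a fully onto extension if, for every (possibly infinite) alphabet $B\supseteq A$ and every basis $B'$ of $F_B\geqslant F_A$, $\theta_{H,K}\colon\Gamma_{B'}(H)\to\Gamma_{B'}(K)$ is onto. *)

(* Defs.v *)
From HB Require Import structures.
From mathcomp Require Import all_boot.
From mathcomp Require Import boolp classical_sets.

Set Implicit Arguments.
Unset Strict Implicit.
Unset Printing Implicit Defensive.

Local Open Scope classical_set_scope.
Local Open Scope group_scope.

(* The letter (a, true) stands for a, and (a, false) for a^-1. *)
Definition letter_inv (A : Type) (x : A * bool) : A * bool := (x.1, ~~ x.2).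

Section FreeGroup.
Variable A : choiceType.
Implicit Types (x y : A * bool) (s t : seq (A * bool)).

Definition word_reduced s : bool := sorted (fun x y => y != letter_inv x) s.

Definition word_push x s : seq (A * bool) :=
  if s is y :: s' then if y == letter_inv x then s' else x :: s else [:: x].

Definition word_reduce s : seq (A * bool) := foldr word_push [::] s.

Definition word_inv s : seq (A * bool) := rev (map (@letter_inv A) s).

Lemma letter_invK : involutive (@letter_inv A).
Proof. by move=> [a b]; rewrite /letter_inv /= negbK. Qed.

Lemma word_push_reduced x s : word_reduced s -> word_reduced (word_push x s).
Proof.
case: s => //= y s; case: ifP => [_ | /negbT yx ps]; last by rewrite /= yx.
exact: path_sorted.
Qed.

Lemma word_reduce_reduced s : word_reduced (word_reduce s).
Proof. by elim: s => //= x s; apply: word_push_reduced. Qed.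

Lemma word_reduce_id s : word_reduced s -> word_reduce s = s.
Proof.
elim: s => //= x s IHs ps; rewrite IHs; last exact: path_sorted ps.
by case: s ps {IHs} => //= y s /andP[/negPf-> _].
Qed.

Lemma word_push_invK x s :
  word_reduced s -> word_push (letter_inv x) (word_push x s) = s.
Proof.
case: s => [|y s] /=; first by rewrite letter_invK eqxx.
have [-> | yx _] := eqVneq y (letter_inv x); last by rewrite /= letter_invK eqxx.
by case: s => //= z s /andP[/negPf->].
Qed.

Lemma word_push_Kinv x s :
  word_reduced s -> word_push x (word_push (letter_inv x) s) = s.
Proof. by move=> rs; rewrite -{1}[x]letter_invK word_push_invK. Qed.

Lemma foldr_push_reduced s t :
  word_reduced t -> word_reduced (foldr word_push t s).
Proof. by move=> rt; elim: s => //= x s; apply: word_push_reduced. Qed.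

Lemma foldr_push_push x s t : word_reduced t ->
  foldr word_push t (word_push x s) = word_push x (foldr word_push t s).
Proof.
move=> rt; case: s => //= y s; case: eqP => //= ->.
by rewrite word_push_Kinv ?foldr_push_reduced.
Qed.

Lemma foldr_push_reduce s t : word_reduced t ->
  foldr word_push t (word_reduce s) = foldr word_push t s.
Proof. by move=> rt; elim: s => //= x s <-; rewrite foldr_push_push. Qed.

Lemma word_reduce_catl s t : word_reduce (word_reduce s ++ t) = word_reduce (s ++ t).
Proof.
by rewrite /word_reduce !foldr_cat foldr_push_reduce ?word_reduce_reduced.
Qed.

Lemma word_reduce_catr s t : word_reduce (s ++ word_reduce t) = word_reduce (s ++ t).
Proof.
rewrite /word_reduce !foldr_cat -/(word_reduce t) -/(word_reduce (word_reduce t)).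
by rewrite word_reduce_id ?word_reduce_reduced.
Qed.

Lemma word_invK : involutive word_inv.
Proof.
by move=> s; rewrite /word_inv map_rev revK mapK //; apply: letter_invK.
Qed.

Lemma word_reduce_inv_cat s : word_reduce (word_inv s ++ s) = [::].
Proof.
elim: s => // x s IHs; rewrite /word_inv /= rev_cons -cats1 -catA /=.
rewrite /word_reduce !foldr_cat /= -/(word_reduce s) in IHs *.
by rewrite word_push_invK ?word_reduce_reduced // IHs.
Qed.

Record freegroup := Freegroup {
  freegroup_word :> seq (A * bool);
  _ : word_reduced freegroup_word }.

HB.instance Definition _ := [isSub for freegroup_word].
HB.instance Definition _ := [Choice of freegroup by <:].

Definition freegroup_of (s : seq (A * bool)) : freegroup :=
  Freegroup (word_reduce_reduced s).

Definition freegroup_one : freegroup := freegroup_of [::].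
Definition freegroup_mul (u v : freegroup) : freegroup := freegroup_of (u ++ v).
Definition freegroup_inv (u : freegroup) : freegroup := freegroup_of (word_inv u).

Lemma freegroup_mulA : associative freegroup_mul.
Proof.
move=> u v w; apply: val_inj => /=.
by rewrite word_reduce_catl word_reduce_catr catA.
Qed.

Lemma freegroup_mul1 : left_id freegroup_one freegroup_mul.
Proof. by move=> u; apply: val_inj; rewrite /= word_reduce_id ?(valP u). Qed.

Lemma freegroup_mulr1 : right_id freegroup_one freegroup_mul.
Proof. by move=> u; apply: val_inj; rewrite /= cats0 word_reduce_id ?(valP u). Qed.

Lemma freegroup_mulV : left_inverse freegroup_one freegroup_inv freegroup_mul.
Proof.
by move=> u; apply: val_inj; rewrite /= word_reduce_catl word_reduce_inv_cat.
Qed.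

Lemma freegroup_mulrV : right_inverse freegroup_one freegroup_inv freegroup_mul.
Proof.
move=> u; apply: val_inj; rewrite /= word_reduce_catr -{1}[val u]word_invK.
exact: word_reduce_inv_cat.
Qed.

HB.instance Definition _ := isGroup.Build freegroup freegroup_mulA
  freegroup_mul1 freegroup_mulr1 freegroup_mulV freegroup_mulrV.

End FreeGroup.

(* For an injective iota, viewed as an inclusion of alphabets, this is the
   inclusion of free groups: the image of a reduced word is then reduced. *)
Definition freegroup_map (A B : choiceType) (iota : A -> B) (u : freegroup A) :
    freegroup B :=
  freegroup_of [seq (iota x.1, x.2) | x <- freegroup_word u].

Definition is_subgroup (F : groupType) (H : set F) : Prop :=
  H 1 /\ forall x y, H x -> H y -> H (x / y).

Definition generated_subgroup (F : groupType) (S : set F) : set F :=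
  smallest (@is_subgroup F) S.

(* Only the restriction of f to C matters. *)
Definition is_basis (F : groupType) (C : set F) : Prop :=
  forall (G : groupType) (f : F -> G),
  exists phi : {multiplicative F -> G},
    (forall c, C c -> phi c = f c) /\
    forall psi : {multiplicative F -> G},
      (forall c, C c -> psi c = f c) -> psi =1 phi.

(* Labels are taken in F itself: C and C^-1 are disjoint when C is a basis. *)
Record involutive_automaton (F : groupType) (C : set F) := InvolutiveAutomaton {
  vertex : Type;
  edge : Type;
  basepoint : vertex;
  source : edge -> vertex;
  target : edge -> vertex;
  label : edge -> F;
  edge_inv : edge -> edge;
  label_letter : forall e, C (label e) \/ C (label e)^-1;
  edge_invK : forall e, edge_inv (edge_inv e) = e;
  source_inv : forall e, source (edge_inv e) = target e;
  target_inv : forall e, target (edge_inv e) = source e;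
  label_inv : forall e, label (edge_inv e) = (label e)^-1 }.

Section Automata.
Variables (F : groupType) (C : set F).
Implicit Types X Y : involutive_automaton C.

Fixpoint is_path X (p : vertex X) (s : seq (edge X)) (q : vertex X) : Prop :=
  if s is e :: s' then source e = p /\ is_path (target e) s' q else p = q.

Definition path_reduced X (s : seq (edge X)) : Prop :=
  forall s1 e s2, s <> s1 ++ [:: e, edge_inv e & s2].

Definition path_label X (s : seq (edge X)) : F := \prod_(e <- s) label e.

Definition deterministic X : Prop :=
  forall e f : edge X, label e = label f ->
    source e = source f \/ target e = target f -> e = f.

Definition connected X : Prop :=
  forall p q : vertex X, exists s, is_path p s q.

Definition trim X : Prop :=
  (forall p : vertex X, exists s1 s2,
     [/\ is_path (basepoint X) s1 p, is_path p s2 (basepoint X)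
       & path_reduced (s1 ++ s2)]) /\
  (forall e : edge X, exists s1 s2,
     is_path (basepoint X) (s1 ++ e :: s2) (basepoint X)
     /\ path_reduced (s1 ++ e :: s2)).

Definition stallings X : Prop := [/\ connected X, deterministic X & trim X].

Definition recognized X : set F :=
  [set x | exists s, [/\ is_path (basepoint X) s (basepoint X),
                         path_reduced s & path_label s = x]].

(* X is (isomorphic to) the Stallings automaton Gamma_C(H). *)
Definition stallings_automaton_of (H : set F) X : Prop :=
  stallings X /\ recognized X = H.

Record automaton_hom X Y := AutomatonHom {
  hom_vertex : vertex X -> vertex Y;
  hom_edge : edge X -> edge Y;
  hom_basepoint : hom_vertex (basepoint X) = basepoint Y;
  hom_source : forall e, source (hom_edge e) = hom_vertex (source e);
  hom_target : forall e, target (hom_edge e) = hom_vertex (target e);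
  hom_label : forall e, label (hom_edge e) = label e }.

Definition hom_onto X Y (theta : automaton_hom X Y) : Prop :=
  (forall q, exists p, hom_vertex theta p = q) /\
  (forall f, exists e, hom_edge theta e = f).

(* theta_{H,K} : Gamma_C(H) -> Gamma_C(K) is onto. Both automata are determined
   up to isomorphism and theta_{H,K} is the only homomorphism between them, so
   the property does not depend on the choices quantified over here. *)
Definition theta_onto (H K : set F) : Prop :=
  forall X Y, stallings_automaton_of H X -> stallings_automaton_of K Y ->
  forall theta : automaton_hom X Y, hom_onto theta.

End Automata.

Definition onto_extension (A : choiceType) (H K : set (freegroup A)) : Prop :=
  forall C : set (freegroup A), is_basis C -> theta_onto C H K.

Definition fully_onto_extension (A : choiceType) (H K : set (freegroup A)) :
    Prop :=
  forall (B : choiceType) (iota : A -> B), injective iota ->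
  forall C : set (freegroup B), is_basis C ->
    theta_onto C (freegroup_map iota @` H) (freegroup_map iota @` K).

(* Main.v *)
(* The edges of Gamma(K) are the pairs (K u, c) with u c v a reduced word of K,
   so theta_{H,K} is onto when each such edge is (K u', c) for some reduced word
   u' c v' of H. A reduced word of <K_i, i in I> is the reduction of a product
   of reduced words of the K_i. Each letter c surviving in it comes from one
   factor a c b in some K_i, and the part of the product before that c lies in
   the same right coset of <K_i, i in I> as a, so a reduced word of H_i crosses
   the corresponding edge. This works one basis at a time, which gives both
   parts. *)
Require Import Defs.
From HB Require Import structures.
From mathcomp Require Import all_boot.
From mathcomp Require Import boolp classical_sets.

Set Implicit Arguments.
Unset Strict Implicit.
Unset Printing Implicit Defensive.

Local Open Scope classical_set_scope.
Local Open Scope group_scope.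

(* gmulf1 and gmulfV do not apply: {multiplicative G -> H} is not recognized
   as a UMagmaMorphism. *)
Lemma multiplicative1 (G H : groupType) (f : {multiplicative G -> H}) : f 1 = 1.
Proof. by apply: (mulgI (f 1)); rewrite -gmulfM !mulg1. Qed.

Lemma multiplicativeV (G H : groupType) (f : {multiplicative G -> H}) :
  {morph f : x / x^-1}.
Proof.
move=> x; apply: (mulgI (f x)).
by rewrite -gmulfM !mulgV multiplicative1.
Qed.

(** * Reduced words over a set of letters and their inverses *)

Section ReducedWords.
Variables (F : groupType) (C : set F).
Implicit Types (c x g : F) (s t u v w : seq F).

Definition letter_word s := forall x, x \in s -> C x \/ C x^-1.

Definition reduced_word s := letter_word s /\ sorted (fun x y => y != x^-1) s.

Lemma letter_word_cat s t :
  letter_word (s ++ t) <-> letter_word s /\ letter_word t.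
Proof.
split=> [st|[ls lt] x]; last by rewrite mem_cat => /orP[/ls|/lt].
by split=> x xs; apply: st; rewrite mem_cat xs ?orbT.
Qed.

Lemma letter_word_cons x s :
  letter_word (x :: s) <-> (C x \/ C x^-1) /\ letter_word s.
Proof.
split=> [xs|[lx ls] y]; last by rewrite inE => /predU1P[->|/ls].
by split=> [|y ys]; apply: xs; rewrite inE ?eqxx ?ys ?orbT.
Qed.

(* Cancellation erases letters without changing the value of the prefix that
   precedes a surviving letter. *)
Lemma reduction_exists s : letter_word s ->
  exists w, [/\ reduced_word w, \prod_(x <- w) x = \prod_(x <- s) x &
    forall u c v, w = u ++ c :: v -> exists s1 s2,
      s = s1 ++ c :: s2 /\ \prod_(x <- s1) x = \prod_(x <- u) x].
Proof.
elim: s => [|x s IHs] ls; first by exists [::]; split=> // -[].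
have /letter_word_cons[lx /IHs[w [[lw rw] ws wP]]] := ls.
case: w lw rw ws wP => [|y w] lw rw ws wP.
  exists [:: x]; rewrite !big_cons -ws; split=> //.
    by split=> //; apply/letter_word_cons.
  move=> [|z [|z' u]] c v //= -[-> _]; by exists [::], s.
have /letter_word_cons[_ lw'] := lw.
have [yx|yx] := eqVneq y x^-1; last first.
  exists [:: x, y & w]; rewrite big_cons ws big_cons; split=> //.
    by split=> [|/=]; [apply/letter_word_cons | rewrite yx].
  move=> [|z u] c v [<-]; first by exists [::], s.
  move=> /wP[s1 [s2 [-> s1u]]]; exists (x :: s1), s2.
  by rewrite !big_cons s1u.
exists w; split.
- by split=> //; apply: path_sorted rw.
- by rewrite big_cons -ws big_cons yx mulVKg.
- move=> u c v wE; have [|s1 [s2 [-> s1u]]] := wP (y :: u) c v.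
    by rewrite wE.
  by exists (x :: s1), s2; rewrite !big_cons s1u big_cons yx mulVKg.
Qed.

Lemma reduced_word_inv s :
  reduced_word s -> reduced_word (rev [seq x^-1 | x <- s]).
Proof.
move=> [ls ss]; split=> [x|].
  rewrite mem_rev => /mapP[y /ls[Cy|Cy] ->]; first by right; rewrite invgK.
  by left.
rewrite rev_sorted sorted_map; apply: sub_sorted ss => x y /=.
by apply: contra_neq; rewrite invgK => ->.
Qed.

End ReducedWords.

Lemma prod_inv_word (F : groupType) (s : seq F) :
  \prod_(x <- rev [seq x^-1 | x <- s]) x = (\prod_(x <- s) x)^-1.
Proof.
elim: s => [|x s IHs]; first by rewrite !big_nil invg1.
by rewrite /= rev_cons -cats1 big_cat IHs big_seq1 big_cons invgM.
Qed.

(** * Normal forms over a basis *)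

Section BasisWords.
Variables (F : groupType) (C : set F).
Hypothesis basisC : is_basis C.
Implicit Types (l : set_type C * bool) (t : seq (set_type C * bool)).

Definition basis_letter l : F := if l.2 then val l.1 else (val l.1)^-1.

Definition basis_eval (u : freegroup (set_type C)) : F :=
  \prod_(l <- freegroup_word u) basis_letter l.

Lemma basis_letter_inv l : basis_letter (letter_inv l) = (basis_letter l)^-1.
Proof. by case: l => c [] //=; rewrite /basis_letter /= invgK. Qed.

Lemma prod_word_reduce t :
  \prod_(l <- word_reduce t) basis_letter l = \prod_(l <- t) basis_letter l.
Proof.
elim: t => //= l t IHt; rewrite big_cons -IHt.
case: (word_reduce t) => [|m r] /=; first by rewrite big_seq1 big_nil mulg1.
have [->|_] := eqVneq m (letter_inv l); last by rewrite !big_cons.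
by rewrite big_cons basis_letter_inv mulVKg.
Qed.

Fact basis_eval_morph : {morph basis_eval : u v / u * v}.
Proof. by move=> u v; rewrite /basis_eval prod_word_reduce big_cat. Qed.

HB.instance Definition _ :=
  isMultiplicative.Build (freegroup (set_type C)) F basis_eval basis_eval_morph.

(** The existence half of the universal property yields [phi] from its values on the letters; the
    uniqueness half shows that evaluating after [phi] is the identity. *)
Lemma basis_decode : exists phi : {multiplicative F -> freegroup (set_type C)},
  (forall t, phi (\prod_(l <- t) basis_letter l) = freegroup_of t) /\
  cancel phi basis_eval.
Proof.
(* Each element of [C] goes to its own generator; the value 1 elsewhere is arbitrary, since only the
   restriction to [C] matters. *)
pose f (x : F) : freegroup (set_type C) :=
  if insub x is Some c then freegroup_of [:: (c, true)] else 1.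
have [phi [phif _]] := basisC f; exists phi; split.
  have phiP l : phi (basis_letter l) = freegroup_of [:: l].
    have phiT (c : set_type C) : phi (val c) = freegroup_of [:: (c, true)].
      by rewrite phif ?/f ?valK //; apply: set_mem (valP c).
    case: l => c []; first exact: phiT.
    rewrite -[basis_letter _]/(val c)^-1 multiplicativeV phiT.
    exact: val_inj.
  elim=> [|l t IHt]; first by rewrite big_nil multiplicative1.
  rewrite big_cons gmulfM phiP IHt; apply: val_inj.
  rewrite -[LHS]/(word_reduce (word_reduce [:: l] ++ word_reduce t)).
  by rewrite word_reduce_catl word_reduce_catr.
(* Both [basis_eval \o phi] and the identity extend the inclusion of [C], so both coincide with
   [id']. *)
have [id' [_ id'P]] := basisC (fun x : F => x).
move=> g; rewrite -[LHS]/((basis_eval \o phi) g).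
have -> : (basis_eval \o phi) g = id' g.
  apply: (id'P (basis_eval \o phi)) => c Cc /=.
  rewrite phif // /f insubT ?mem_set // => cC.
  by rewrite /basis_eval /= big_seq1.
by rewrite -(id'P idfun).
Qed.

(** A cancelling pair of signed letters evaluates to a cancelling pair in [F], so any lift of a
    reduced word to signed letters is reduced. *)
Lemma reduced_word_decode s : reduced_word C s ->
  exists t, word_reduced t /\ s = map basis_letter t.
Proof.
move=> [ls ss].
have [t st] : exists t, s = map basis_letter t.
  elim: s ls {ss} => [|x s IHs]; first by exists [::].
  move=> /letter_word_cons[lx /IHs[t ->]].
  have [l ->] : exists l, x = basis_letter l.
    case: lx => /mem_set Cx; first by exists (Sub x Cx, true).
    by exists (Sub x^-1 Cx, false); rewrite /basis_letter /= invgK.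
  by exists (l :: t).
exists t; split=> //; move: ss; rewrite st sorted_map.
apply: sub_sorted => l m /=; apply: contra_neq => ->.
exact: basis_letter_inv.
Qed.

(** The decoding morphism recovers from the common product the signed word behind each side, as both
    are already reduced. *)
Lemma reduced_word_unique s w : reduced_word C s -> reduced_word C w ->
  \prod_(x <- s) x = \prod_(x <- w) x -> s = w.
Proof.
move=> /reduced_word_decode[s' [rs ->]] /reduced_word_decode[t' [rt ->]].
have [phi [phiP _]] := basis_decode.
rewrite !big_map => /(congr1 phi); rewrite !phiP => /(congr1 val) /=.
by rewrite !word_reduce_id // => ->.
Qed.

Lemma reduced_word_exists (g : F) :
  exists w, reduced_word C w /\ \prod_(x <- w) x = g.
Proof.
have [phi [_ phiK]] := basis_decode.
(* Reducing again inside [F] avoids proving that [basis_letter] is injective. *)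
have [|w [rw wP _]] := @reduction_exists _ C (map basis_letter (phi g)).
  move=> _ /mapP[[c b] _ ->]; have Cc := set_mem (valP c).
  by case: b; rewrite /basis_letter /= ?invgK; [left | right].
by exists w; rewrite wP big_map -[RHS]phiK.
Qed.

End BasisWords.

(** * Subgroups and generation *)

Section Subgroups.
Variable F : groupType.
Implicit Types (H K S : set F) (x y : F).

Lemma subgroup1 H : is_subgroup H -> H 1. Proof. by case. Qed.

Lemma subgroupV H x : is_subgroup H -> H x -> H x^-1.
Proof. by move=> [H1 HD] Hx; rewrite -[x^-1]mul1g; apply: HD. Qed.

Lemma subgroupM H x y : is_subgroup H -> H x -> H y -> H (x * y).
Proof.
move=> sH Hx Hy; rewrite -[y]invgK; apply: sH.2 => //; exact: subgroupV.
Qed.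

Lemma generated_subgroupP S : is_subgroup (generated_subgroup S).
Proof.
split=> [M [[]]|x y Sx Sy M MS] //.
by case: (MS) => sM _; apply: sM.2; [apply: Sx | apply: Sy].
Qed.

Lemma generated_subgroup_bigcup (I : Type) (L : I -> set F) i :
  L i `<=` generated_subgroup (\bigcup_j L j).
Proof. by move=> x Lx; apply: sub_gen_smallest; exists i. Qed.

End Subgroups.

Lemma cat_eq_cat_cons (T : Type) (s t u v : seq T) (c : T) :
  s ++ t = u ++ c :: v ->
  (exists v', s = u ++ c :: v') \/ (exists u', u = s ++ u' /\ t = u' ++ c :: v).
Proof.
elim: s u => [|x s IHs] [|y u] //=; first by move=> ->; right; exists [::].
- by move=> ->; right; exists (y :: u).
- by move=> [-> _]; left; exists s.
- move=> [-> /IHs[[v' ->]|[u' [-> ->]]]]; first by left; exists v'.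
  by right; exists u'.
Qed.

(** * Covering of letter occurrences, and its stability under generation *)

Section Covering.
Variables (F : groupType) (C : set F).
Hypothesis basisC : is_basis C.
Implicit Types (H K : set F) (c x y : F) (s t u v w : seq F).

(* Says that theta_{H,K} is onto on edges. *)
Definition covers H K := forall u c v,
  reduced_word C (u ++ c :: v) -> K (\prod_(x <- u ++ c :: v) x) ->
  exists u' v', [/\ reduced_word C (u' ++ c :: v'),
    H (\prod_(x <- u' ++ c :: v') x) &
    K ((\prod_(x <- u') x) / (\prod_(x <- u) x))].

Lemma covers_generated (I : Type) (H K : I -> set F) :
    (forall i, is_subgroup (K i)) -> (forall i, covers (H i) (K i)) ->
  covers (generated_subgroup (\bigcup_i H i))
         (generated_subgroup (\bigcup_i K i)).
Proof.
move=> sK HK.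
set HH := generated_subgroup _; set KK := generated_subgroup (\bigcup_i K i).
have sKK : is_subgroup KK by exact: generated_subgroupP.
(* The word [s] need not be reduced, so [Q] passes to products by mere concatenation; reduction is
   postponed to the end. *)
pose Q g := KK g /\ exists s, [/\ letter_word C s, \prod_(x <- s) x = g &
  forall u c v, s = u ++ c :: v -> exists u' v',
    [/\ reduced_word C (u' ++ c :: v'), HH (\prod_(x <- u' ++ c :: v') x) &
      KK ((\prod_(x <- u') x) / (\prod_(x <- u) x))]].
have Q1 : Q 1.
  split; first exact: (subgroup1 sKK).
  by exists [::]; rewrite big_nil; split=> // -[].
have QM x y : Q x -> Q y -> Q (x * y).
  move=> [Kx [s [ls sx sP]]] [Ky [t [lt ty tP]]].
  split; first exact: (subgroupM sKK).
  exists (s ++ t); split; first exact/letter_word_cat.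
    by rewrite big_cat sx ty.
  move=> u c v stE; have [[v' sE]|[u' [-> tE]]] := cat_eq_cat_cons stE.
    exact: sP sE.
  have [u'' [v'' [r'' h'' k'']]] := tP _ _ _ tE; exists u'', v''; split=> //.
  (* The letter lies in the second factor: its prefix is lengthened on the left by [x], an element
     of [KK], which leaves the right coset unchanged. *)
  rewrite big_cat sx invgM mulgA.
  by apply: (subgroupM sKK) => //; apply: (subgroupV sKK).
have QK i g : K i g -> Q g.
  move=> Kg; split; first exact: generated_subgroup_bigcup Kg.
  have [s [rs sg]] := reduced_word_exists basisC g.
  exists s; split=> //; first by case: rs.
  move=> u c v sE; rewrite sE in rs sg; rewrite -sg in Kg.
  have [u' [v' [r' h' k']]] := HK i _ _ _ rs Kg.
  by exists u', v'; split=> //; apply: generated_subgroup_bigcup; eassumption.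
(* [Q] is not visibly closed under inverses, so it is symmetrized; the generators qualify because
   each [K i] contains inverses. *)
have QQ : KK `<=` [set g | Q g /\ Q g^-1].
  apply: smallest_sub.
    split=> [|x y [Qx Qx'] [Qy Qy']]; first by rewrite /= invg1.
    by split; [|rewrite invgM invgK]; apply: QM.
  by move=> g [i _ Kg]; split; apply: (QK i) => //; apply: (subgroupV (sK i)).
move=> u c v rw /QQ[[_ [s [ls sE sP]]] _].
(* By uniqueness of normal forms, reducing [s] gives the word at hand, so its letter [c] comes from
   a letter of [s] whose prefix has the same value. *)
have [w [rw' wE wP]] := reduction_exists ls.
have ww : w = u ++ c :: v.
  by apply: (reduced_word_unique basisC) => //; rewrite wE.
have [s1 [s2 [s12 <-]]] := wP _ _ _ ww.
exact: sP s12.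
Qed.

End Covering.

Lemma map_eq_cat_cons (S T : Type) (f : S -> T) (s : seq S) u c v :
  map f s = u ++ c :: v -> exists s1 x s2,
    [/\ s = s1 ++ x :: s2, map f s1 = u, f x = c & map f s2 = v].
Proof.
elim: u s => [|d u IHu] [|x s] //= [].
  by move=> <- <-; exists [::], x, s.
move=> <- /IHu[s1 [y [s2 [-> <- <- <-]]]].
by exists (x :: s1), y, s2.
Qed.

(** * Paths in deterministic automata *)

Section Paths.
Variables (F : groupType) (C : set F).
Variable X : involutive_automaton C.
Implicit Types (p q r : vertex X) (e f : edge X) (s t : seq (edge X)).

Lemma is_path_cat p s t q :
  is_path p (s ++ t) q <-> exists r, is_path p s r /\ is_path r t q.
Proof.
elim: s p => [|e s IHs] p /=.
  by split=> [pq|[r [-> //]]]; exists p.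
split=> [[-> /IHs[r [sr rq]]]|[r [[-> sr] rq]]]; first by exists r.
by split=> //; apply/IHs; exists r.
Qed.

Lemma is_path_functional p s q r : is_path p s q -> is_path p s r -> q = r.
Proof.
elim: s p => [|e s IHs] p /=; first by move=> <-.
by move=> [_ sq] [_ /(IHs _ sq)].
Qed.

(** Serves to derive surjectivity on vertices from surjectivity on edges. *)
Lemma is_path_last p s q : is_path p s q -> p = q \/ exists e, target e = q.
Proof.
elim: s p => [|e s IHs] p /=; first by left.
by move=> [_ /IHs[eq|]]; right=> //; exists e.
Qed.

Lemma path_labelE s : path_label s = \prod_(x <- map (@label _ _ X) s) x.
Proof. by rewrite big_map. Qed.

Lemma label_letter_word s : letter_word C (map (@label _ _ X) s).
Proof.
elim: s => // e s IHs; apply/letter_word_cons; split=> //; exact: label_letter.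
Qed.

Lemma path_reduced_label s :
  reduced_word C (map (@label _ _ X) s) -> path_reduced s.
Proof.
move=> [_ ss] s1 e s2 sE; move: ss.
rewrite sE map_cat /= label_inv => /cat_sorted2[_].
by rewrite /= eqxx.
Qed.

Hypothesis detX : deterministic X.

Lemma label_edge_inv e f :
  source f = target e -> label f = (label e)^-1 -> f = edge_inv e.
Proof.
by move=> fe fl; apply: detX; rewrite ?label_inv ?source_inv //; left.
Qed.

(** By determinism, consecutive edges with inverse labels are inverse edges, which a reduced path
    excludes. *)
Lemma reduced_word_label p s q : is_path p s q -> path_reduced s ->
  reduced_word C (map (@label _ _ X) s).
Proof.
move=> sp sr; split; first exact: label_letter_word.
elim: s p sp sr => //= e [|f s] //= IHs p [_ sp] sr.
apply/andP; split; last first.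
  by apply: IHs sp _ => s1 e' s2 E; apply: (sr (e :: s1) e' s2); rewrite E.
apply/eqP => fl; apply: (sr [::] e s).
by rewrite /= -(label_edge_inv sp.1 fl).
Qed.

Lemma is_path_deterministic p s t q r : is_path p s q -> is_path p t r ->
  map (@label _ _ X) s = map (@label _ _ X) t -> s = t.
Proof.
elim: s p t => [|e s IHs] p [|f t] //= [ep sq] [fp tr] [ef st].
have fe : e = f by apply: detX => //; left; rewrite ep.
by rewrite fe in sq *; rewrite (IHs _ _ sq tr st).
Qed.

(** A cancelling pair of labels is a backtracking, by determinism, so erasing it keeps the ends of
    the path and its value. *)
Lemma is_path_reduction p s q : is_path p s q -> exists t,
  [/\ is_path p t q, reduced_word C (map (@label _ _ X) t) &
      path_label t = path_label s].
Proof.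
elim: s p => [|e s IHs] p /=; first by move=> ->; exists [::].
move=> [ep /IHs[t [tq rt ts]]].
case: t tq rt ts => [|f t] tq rt ts.
  exists [:: e]; split=> //.
    by split=> //; apply: label_letter_word.
  by rewrite /path_label !big_cons -/(path_label s) -ts.
have [fe|fe] := eqVneq (label f) (label e)^-1.
  have fE := label_edge_inv tq.1 fe.
  exists t; split.
  - by case: tq => _; rewrite fE target_inv ep.
  - split; first exact: label_letter_word.
    by case: rt => _ /path_sorted.
  - rewrite /path_label big_cons -/(path_label s) -ts /path_label big_cons.
    by rewrite fe mulVKg.
exists [:: e, f & t]; split=> //.
  split; first exact: label_letter_word.
  by case: rt => _ /= ->; rewrite fe.
by rewrite /path_label big_cons -/(path_label (f :: t)) ts [RHS]big_cons.
Qed.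

(** Both paths reduce to paths reading the same normal form, and determinism makes these one
    path. *)
Lemma is_path_label_end p s t q r : is_basis C ->
  is_path p s q -> is_path p t r -> path_label s = path_label t -> q = r.
Proof.
move=> basisC /is_path_reduction[s' [s'q rs' <-]].
move=> /is_path_reduction[t' [t'r rt' <-]].
rewrite !path_labelE => /(reduced_word_unique basisC rs' rt') E.
have st := is_path_deterministic s'q t'r E; rewrite -st in t'r.
exact: is_path_functional s'q t'r.
Qed.

End Paths.

(** * Homomorphisms, and surjectivity from covering *)

Lemma is_path_hom (F : groupType) (C : set F) (X Y : involutive_automaton C)
    (theta : automaton_hom X Y) p s q : is_path p s q ->
  is_path (hom_vertex theta p) (map (hom_edge theta) s) (hom_vertex theta q).
Proof.
elim: s p => [|e s IHs] p /=; first by move=> ->.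
by move=> [<- /IHs]; rewrite hom_source hom_target.
Qed.

Lemma path_label_hom (F : groupType) (C : set F) (X Y : involutive_automaton C)
    (theta : automaton_hom X Y) s :
  path_label (map (hom_edge theta) s) = path_label s.
Proof.
by rewrite /path_label big_map; apply: eq_bigr => e _; apply: hom_label.
Qed.

Lemma covers_theta_onto (F : groupType) (C : set F) (H K : set F) :
  is_basis C -> covers C H K -> theta_onto C H K.
Proof.
move=> basisC HK X Y [[_ dX _] XH] [[_ dY [tYv tYe]] YK] theta.
have onto_edge f : exists e, hom_edge theta e = f.
  (* Trimness puts [f] on a reduced loop, which spells a word of [K]; covering then supplies a word
     of [H] with a matching letter. *)
  have [s1 [s2 [sp sr]]] := tYe f.
  have := reduced_word_label dY sp sr; rewrite map_cat /= => rw.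
  have [|u' [v' [r' h' k']]] := HK _ _ _ rw.
    by rewrite -YK; exists (s1 ++ f :: s2); rewrite path_labelE map_cat.
  rewrite -XH in h'; have [s [sq rs sl]] := h'.
  have lsE : map (@label _ _ X) s = u' ++ label f :: v'.
    apply: (reduced_word_unique basisC) => //.
      exact: reduced_word_label sq rs.
    by rewrite -path_labelE.
  have [a [e [b [sE au ef _]]]] := map_eq_cat_cons lsE.
  exists e; apply: (dY); first by rewrite hom_label.
  left; rewrite hom_source.
  move: sq; rewrite sE => /is_path_cat[r [/(is_path_hom theta) ar [re _]]].
  rewrite re; move: sp => /is_path_cat[z [s1z [zf _]]].
  (* The loop [t] in [Y] corrects the prefix: [t ++ s1] and the image of [a] have the same value,
     hence the same end, so the image of [e] starts where [f] does. *)
  rewrite zf; rewrite -{1}YK in k'; have [t [tq _ tl]] := k'.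
  have ts1 : is_path (basepoint Y) (t ++ s1) z.
    by apply/is_path_cat; exists (basepoint Y).
  rewrite hom_basepoint in ar; apply: (is_path_label_end dY basisC ar ts1).
  rewrite path_label_hom /path_label big_cat -!/(path_label _) tl.
  by rewrite !path_labelE au /= mulgVK.
split=> // q; have [s1 [_ [/is_path_last[<-|[f <-]] _ _]]] := tYv q.
  by exists (basepoint X); rewrite hom_basepoint.
by have [e <-] := onto_edge f; exists (target e); rewrite hom_target.
Qed.

(* Gamma_C(K) is realized as the core of the Schreier graph of K: the vertices
   are right cosets, and an edge is a pair of its source and its label. *)
Section Core.
Variables (F : groupType) (C K : set F).
Hypotheses (basisC : is_basis C) (sK : is_subgroup K).
Implicit Types (g h x : F) (u v w : seq F) (V : set F).

(** This is the right coset K g; [translate] below is right multiplication of a set, the move along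
    an edge of the Schreier graph. *)
Definition coset_of_elt g : set F := [set h | K (h / g)].

Definition translate V x : set F := [set h | V (h / x)].

Lemma translate_coset g x : translate (coset_of_elt g) x = coset_of_elt (g * x).
Proof.
by apply/predeqP => h; rewrite /translate /coset_of_elt /= invgM mulgA.
Qed.

Lemma translateK V x : translate (translate V x) x^-1 = V.
Proof.
by apply/predeqP => h; rewrite /translate /= invgK mulgK.
Qed.

Lemma coset_of_elt_mull k g : K k -> coset_of_elt (k * g) = coset_of_elt g.
Proof.
move=> Kk; apply/predeqP => h; rewrite /coset_of_elt /= invgM mulgA.
split=> Kh; last by apply: (subgroupM sK) => //; apply: subgroupV.
by rewrite -(mulgVK k (h / g)); apply: (subgroupM sK).
Qed.

Lemma coset_of_elt_self g : coset_of_elt g g.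
Proof. by rewrite /coset_of_elt /= mulgV; apply: subgroup1. Qed.

(** Keeping only the cosets visited while reading a reduced word of [K] builds trimness into the
    vertices; the next definition does so for edges. *)
Definition core_vertex_spec V := exists u v, [/\ reduced_word C (u ++ v),
  K (\prod_(x <- u ++ v) x) & V = coset_of_elt (\prod_(x <- u) x)].

Definition core_edge_spec (Vx : set F * F) := exists u v,
  [/\ reduced_word C (u ++ Vx.2 :: v), K (\prod_(x <- u ++ Vx.2 :: v) x)
    & Vx.1 = coset_of_elt (\prod_(x <- u) x)].

Definition core_vertex := {V | core_vertex_spec V}.
Definition core_edge := {Vx | core_edge_spec Vx}.

Lemma core_vertex_inj (p q : core_vertex) : sval p = sval q -> p = q.
Proof. by case: p q => [V P] [W Q] /= VW; apply: eq_exist. Qed.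

Lemma core_edge_inj (e f : core_edge) : sval e = sval f -> e = f.
Proof. by case: e f => [V P] [W Q] /= VW; apply: eq_exist. Qed.

Fact core_basepoint_subproof : core_vertex_spec (coset_of_elt 1).
Proof.
exists [::], [::]; rewrite big_nil; split=> //; exact: subgroup1.
Qed.

Fact core_source_subproof Vx : core_edge_spec Vx -> core_vertex_spec Vx.1.
Proof. by move=> [u [v [r k e]]]; exists u, (Vx.2 :: v). Qed.

Fact core_target_subproof Vx :
  core_edge_spec Vx -> core_vertex_spec (translate Vx.1 Vx.2).
Proof.
case: Vx => V x [u [v [/= r k ->]]]; exists (rcons u x), v.
rewrite cat_rcons; split=> //.
by rewrite translate_coset -cats1 big_cat big_seq1.
Qed.

Fact core_edge_inv_subproof Vx :
  core_edge_spec Vx -> core_edge_spec (translate Vx.1 Vx.2, Vx.2^-1).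
Proof.
case: Vx => V x [u [v [/= r k ->]]].
exists (rev [seq y^-1 | y <- v]), (rev [seq y^-1 | y <- u]).
have E : rev [seq y^-1 | y <- v] ++ x^-1 :: rev [seq y^-1 | y <- u] =
    rev [seq y^-1 | y <- u ++ x :: v].
  by rewrite map_cat /= rev_cat rev_cons cat_rcons.
split; rewrite /= ?E; first exact: reduced_word_inv.
  by rewrite prod_inv_word; apply: subgroupV.
(* The inverse word has prefix v^-1, and K v^-1 = K (u x v) v^-1 = K u x because u x v lies in
   [K]. *)
rewrite translate_coset prod_inv_word -[RHS](coset_of_elt_mull _ k).
by rewrite big_cat big_cons /= !mulgA mulgK.
Qed.

Definition core_source (e : core_edge) : core_vertex :=
  exist _ _ (core_source_subproof (svalP e)).
Definition core_target (e : core_edge) : core_vertex :=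
  exist _ _ (core_target_subproof (svalP e)).
Definition core_edge_inv (e : core_edge) : core_edge :=
  exist _ _ (core_edge_inv_subproof (svalP e)).

Fact core_label_letter (e : core_edge) : C (sval e).2 \/ C (sval e).2^-1.
Proof.
case: e => Vx /= [u [v [[r _] _ _]]]; apply: r.
by rewrite mem_cat inE eqxx orbT.
Qed.

Fact core_edge_invK e : core_edge_inv (core_edge_inv e) = e.
Proof.
by case: e => [[V x] P]; apply: core_edge_inj; rewrite /= translateK invgK.
Qed.

Fact core_target_inv e : core_target (core_edge_inv e) = core_source e.
Proof.
by case: e => [[V x] P]; apply: core_vertex_inj; rewrite /= translateK.
Qed.

Fact core_source_inv e : core_source (core_edge_inv e) = core_target e.
Proof. exact: core_vertex_inj. Qed.

Definition core : involutive_automaton C :=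
  @InvolutiveAutomaton F C core_vertex core_edge
    (exist _ _ core_basepoint_subproof) core_source core_target
    (fun e => (sval e).2) core_edge_inv core_label_letter core_edge_invK
    core_source_inv core_target_inv (fun e => erefl).

(** Translation by the label is invertible, so the target and the label also determine the
    source. *)
Lemma core_deterministic : deterministic core.
Proof.
move=> [[V x] P] [[W y] Q] /= xy; case=> /(congr1 sval) /= VW;
  apply: core_edge_inj; rewrite /= xy ?VW //.
by rewrite -(translateK V x) VW xy translateK.
Qed.

Lemma core_path_end (p q : vertex core) s g : is_path p s q ->
  sval p = coset_of_elt g -> sval q = coset_of_elt (g * path_label s).
Proof.
elim: s p g => [|e s IHs] p g /=.
  by move=> -> ->; rewrite /path_label big_nil mulg1.
move=> [ep sq] pg; rewrite /path_label big_cons mulgA.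
by apply: IHs sq _ => /=; rewrite -translate_coset -pg -ep.
Qed.

Lemma core_path_exists u v (p : vertex core) :
    reduced_word C (u ++ v) -> K (\prod_(x <- u ++ v) x) ->
    sval p = coset_of_elt (\prod_(x <- u) x) ->
  exists s, is_path p s (basepoint core) /\ map (@label _ _ core) s = v.
Proof.
(* Letters move one by one from [v] to the prefix [u], whose coset is the current vertex; at the end
   [u] is in [K] and the vertex is the basepoint. *)
elim: v u p => [|x v IHv] u p r k pu.
  exists [::]; split=> //=; apply: core_vertex_inj; rewrite /= pu.
  by rewrite cats0 in k; rewrite -[X in coset_of_elt X]mulg1 coset_of_elt_mull.
have P : core_edge_spec (sval p, x) by exists u, v.
have [||| s [sq sv]] := IHv (rcons u x) (@target _ _ core (exist _ _ P)).
- by rewrite cat_rcons.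
- by rewrite cat_rcons.
- by rewrite /= pu translate_coset -cats1 big_cat big_seq1.
exists ((exist _ _ P : edge core) :: s); split; last by rewrite /= sv.
by split=> //; apply: core_vertex_inj.
Qed.

Lemma core_loop_exists w : reduced_word C w -> K (\prod_(x <- w) x) ->
  exists s, [/\ is_path (basepoint core) s (basepoint core), path_reduced s &
    map (@label _ _ core) s = w].
Proof.
move=> r k; have [|s [sp sw]] := @core_path_exists [::] w (basepoint core) r k.
  by rewrite big_nil.
by exists s; split=> //; apply: path_reduced_label; rewrite sw.
Qed.

Lemma core_vertex_loop (p : vertex core) : exists s1 s2,
  [/\ is_path (basepoint core) s1 p, is_path p s2 (basepoint core)
    & path_reduced (s1 ++ s2)].
Proof.
have [u [v [r k pu]]] := svalP p.
have [s [sp sr sw]] := core_loop_exists r k.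
have sE := cat_take_drop (size u) s.
move: sp sr; rewrite -sE => /is_path_cat[q [sq qs]] sr.
(* Cutting the loop after [size u] edges stops at the coset of [u], which is [p]. *)
exists (take (size u) s), (drop (size u) s).
suff qp : q = p by rewrite qp in sq qs.
apply: core_vertex_inj; rewrite (core_path_end sq erefl) mul1g pu.
by rewrite path_labelE map_take sw take_size_cat.
Qed.

Lemma core_edge_loop (e : edge core) : exists s1 s2,
  is_path (basepoint core) (s1 ++ e :: s2) (basepoint core) /\
  path_reduced (s1 ++ e :: s2).
Proof.
have [u [v [r k pu]]] := svalP e.
have [s [sp sr sw]] := core_loop_exists r k.
have [s1 [f [s2 [sE s1u fe _]]]] := map_eq_cat_cons sw.
exists s1, s2; suff <- : f = e by rewrite -sE.
apply: core_deterministic => //; left; apply: core_vertex_inj.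
move: sp; rewrite sE => /is_path_cat[q [s1q [-> _]]].
by rewrite (core_path_end s1q erefl) mul1g path_labelE s1u -pu.
Qed.

Lemma core_connected : connected core.
Proof.
move=> p q; have [_ [s [_ sp _]]] := core_vertex_loop p.
have [t [_ [tq _ _]]] := core_vertex_loop q.
by exists (s ++ t); apply/is_path_cat; exists (basepoint core).
Qed.

Lemma core_recognized : recognized core = K.
Proof.
apply/predeqP => g; split=> [[s [sp _ <-]]|Kg].
  (* A closed path with value g forces K g = K, and g belongs to K g. *)
  have /= := core_path_end sp erefl; rewrite mul1g => E.
  have := coset_of_elt_self (path_label s); rewrite -E /coset_of_elt /=.
  by rewrite invg1 mulg1.
have [w [rw wg]] := reduced_word_exists basisC g.
rewrite -wg in Kg *; have [s [sp sr sw]] := core_loop_exists rw Kg.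
by exists s; rewrite path_labelE sw.
Qed.

Lemma core_stallings : stallings_automaton_of K core.
Proof.
split; last exact: core_recognized.
split; [exact: core_connected | exact: core_deterministic | split].
  exact: core_vertex_loop.
exact: core_edge_loop.
Qed.

End Core.

(** * The homomorphism between cores, and covering from surjectivity *)

Section CoreHom.
Variables (F : groupType) (C H K : set F).
Hypotheses (basisC : is_basis C) (sH : is_subgroup H) (sK : is_subgroup K).
Hypothesis leHK : H `<=` K.
Implicit Types (g x : F) (V : set F).

(** This is the product set K V: it sends H g to K g without choosing representatives. *)
Definition saturate V : set F := [set h | exists2 g, V g & K (h / g)].

Lemma saturate_coset g : saturate (coset_of_elt H g) = coset_of_elt K g.
Proof.
apply/predeqP => h; split=> [[k /leHK Hk Kh]|Kh].
  rewrite /coset_of_elt /= -(mulgVK k h) -mulgA; exact: subgroupM.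
by exists g => //; apply: coset_of_elt_self.
Qed.

Lemma saturate_translate V x :
  saturate (translate V x) = translate (saturate V) x.
Proof.
apply/predeqP => h; split=> [[g Vg Kh]|[g Vg Kh]].
  by exists (g / x); rewrite // invgF mulgA mulgVK.
by exists (g * x); rewrite /translate /= ?mulgK // invgM mulgA.
Qed.

Fact core_hom_vertex_subproof V :
  core_vertex_spec C H V -> core_vertex_spec C K (saturate V).
Proof.
move=> [u [v [r k ->]]]; exists u, v; rewrite saturate_coset; split=> //.
exact: leHK.
Qed.

Fact core_hom_edge_subproof Vx :
  core_edge_spec C H Vx -> core_edge_spec C K (saturate Vx.1, Vx.2).
Proof.
move=> [u [v [r k ->]]]; exists u, v; rewrite saturate_coset; split=> //.
exact: leHK.
Qed.

Definition core_hom_vertex (p : vertex (core C sH)) : vertex (core C sK) :=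
  exist _ _ (core_hom_vertex_subproof (svalP p)).
Definition core_hom_edge (e : edge (core C sH)) : edge (core C sK) :=
  exist _ _ (core_hom_edge_subproof (svalP e)).

Fact core_hom_basepoint :
  core_hom_vertex (basepoint (core C sH)) = basepoint (core C sK).
Proof. by apply: core_vertex_inj; rewrite /= saturate_coset. Qed.

Fact core_hom_source e :
  source (core_hom_edge e) = core_hom_vertex (source e).
Proof. exact: core_vertex_inj. Qed.

Fact core_hom_target e :
  target (core_hom_edge e) = core_hom_vertex (target e).
Proof. by apply: core_vertex_inj; rewrite /= saturate_translate. Qed.

Definition core_hom : automaton_hom (core C sH) (core C sK) :=
  AutomatonHom core_hom_basepoint core_hom_source core_hom_target
    (fun e => erefl).

(** [theta_onto] speaks of all Stallings automata, so it applies to the cores, where an edge is a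
    coset with a letter and a preimage of it is the required word of [H]. *)
Lemma theta_onto_covers : theta_onto C H K -> covers C H K.
Proof.
move=> HK u c v r k.
have [_ onto_edge] := HK _ _ (core_stallings basisC sH)
  (core_stallings basisC sK) core_hom.
have P : core_edge_spec C K (coset_of_elt K (\prod_(x <- u) x), c).
  by exists u, v.
have [[[V x] [u' [v' [/= r' k' VE]]]] /(congr1 sval) /=] :=
  onto_edge (exist _ _ P).
move=> [VK xc]; rewrite -xc; exists u', v'; split=> //.
have := coset_of_elt_self sK (\prod_(x <- u') x).
by rewrite -saturate_coset -VE VK.
Qed.

End CoreHom.

Lemma theta_onto_generated (F : groupType) (C : set F) (I : Type)
    (H K : I -> set F) : is_basis C ->
    (forall i, is_subgroup (H i)) -> (forall i, is_subgroup (K i)) ->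
    (forall i, H i `<=` K i) -> (forall i, theta_onto C (H i) (K i)) ->
  theta_onto C (generated_subgroup (\bigcup_i H i))
               (generated_subgroup (\bigcup_i K i)).
Proof.
move=> basisC sH sK leHK HK; apply: covers_theta_onto => //.
apply: covers_generated => // i; exact: theta_onto_covers.
Qed.

(** * Change of alphabet and images of subgroups *)

Section FreeGroupMap.
Variables (A B : choiceType) (iota : A -> B).

Let letter_map (x : A * bool) : B * bool := (iota x.1, x.2).

(** Relabelling commutes with inverting letters, so every cancellation survives it. *)
Lemma word_reduce_map_reduce (s : seq (A * bool)) :
  word_reduce (map letter_map (word_reduce s)) = word_reduce (map letter_map s).
Proof.
elim: s => //= x s <-; case: (word_reduce s) => [|y t] //=.
have [->|_] := eqVneq y (letter_inv x); last by [].
by rewrite word_push_Kinv ?word_reduce_reduced.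
Qed.

Fact freegroup_map_morph :
  {morph freegroup_map iota : u v / (u * v)%g >-> (u * v)%g}.
Proof.
move=> u v; apply: val_inj.
rewrite -[LHS]/(word_reduce (map letter_map (word_reduce (u ++ v)))).
rewrite word_reduce_map_reduce map_cat.
by rewrite -word_reduce_catl -word_reduce_catr.
Qed.

HB.instance Definition _ := isMultiplicative.Build (freegroup A) (freegroup B)
  (freegroup_map iota) freegroup_map_morph.

End FreeGroupMap.

Section ImageSubgroup.
Variables (G H : groupType) (f : {multiplicative G -> H}).

Lemma image_subgroup (L : set G) : is_subgroup L -> is_subgroup (f @` L).
Proof.
move=> sL; split.
  by exists 1; [exact: subgroup1 | exact: multiplicative1].
move=> _ _ [x Lx <-] [y Ly <-]; exists (x / y); first exact: sL.2.
by rewrite gmulfM multiplicativeV.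
Qed.

Lemma preimage_subgroup (L : set H) : is_subgroup L -> is_subgroup (f @^-1` L).
Proof.
move=> sL; split; first by rewrite /preimage /= multiplicative1; case: sL.
move=> x y Lx Ly; rewrite /preimage /= gmulfM multiplicativeV.
exact: sL.2.
Qed.

(** Each inclusion is minimality of a generated subgroup, tested against a preimage in one direction
    and an image in the other. *)
Lemma image_generated_subgroup (I : Type) (L : I -> set G) :
  f @` generated_subgroup (\bigcup_i L i) =
  generated_subgroup (\bigcup_i (f @` L i)).
Proof.
apply/seteqP; split.
  apply/image_subP; apply: smallest_sub.
    exact/preimage_subgroup/generated_subgroupP.
  move=> x [i _ Lx].
  apply: (@generated_subgroup_bigcup _ _ (fun i => f @` L i) i).
  by exists x.
apply: smallest_sub; first exact/image_subgroup/generated_subgroupP.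
move=> _ [i _ [x Lx <-]]; exists x => //; exact: generated_subgroup_bigcup Lx.
Qed.

End ImageSubgroup.

Theorem proposition3p4 (A : finType) (I : Type) (H K : I -> set (freegroup A))
    (subH : forall i, is_subgroup (H i)) (subK : forall i, is_subgroup (K i))
    (leHK : forall i, H i `<=` K i) :
  ((forall i, onto_extension (H i) (K i)) ->
     onto_extension (generated_subgroup (\bigcup_i H i))
                    (generated_subgroup (\bigcup_i K i))) /\
  ((forall i, fully_onto_extension (H i) (K i)) ->
     fully_onto_extension (generated_subgroup (\bigcup_i H i))
                          (generated_subgroup (\bigcup_i K i))).
Proof.
split=> [HK C basisC | HK B iota iotaI C basisC].
  by apply: theta_onto_generated => // i; apply: HK.
(* The family is moved into the larger free group, where [C] is a basis, before the fixed-basis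
   result is applied. *)
rewrite !image_generated_subgroup.
apply: theta_onto_generated => // i; try exact: image_subgroup.
  by apply: image_subset.
exact: HK.
Qed.
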